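(* Let $n\ge 4$. Then there exist indices $1\le i\ne j\le \binom{n}{2}$ such that $\mathscr{Y}_{n,i}\mathscr{Y}_{n,j}\neq \mathscr{Y}_{n,j}\mathscr{Y}_{n,i}$ in $H_n(q)$; equivalently, there exist $z,z'\in\mathbb{C}(q)$ such that $\mathscr{S}_n(z)\mathscr{S}_n(z')\ne \mathscr{S}_n(z')\mathscr{S}_n(z)$.
   Context: Let $q$ be an indeterminate. $H_n(q)$ is the unital associative $\mathbb{C}(q)$-algebra generated by $T_1,\dots,T_{n-1}$ with relations $T_i^2=(q-1)T_i+q$ for $1\le i\le n-1$, $T_iT_j=T_jT_i$ for $|i-j|\ge2$, and $T_iT_{i+1}T_i=T_{i+1}T_iT_{i+1}$ for $1\le i\le n-2$. Let $\mathfrak{S}_n$ be the symmetric group with simple transpositions $s_i=(i,i+1)$ and Coxeter length $\ell$. For $w\in\mathfrak{S}_n$ with reduced expression $w=s_{i_1}\cdots s_{i_k}$ put $T_w=T_{i_1}\cdots T_{i_k}$ (with $T_e=1$); this is independent of the reduced expression and $\{T_w : w\in\mathfrak{S}_n\}$ is a $\mathbb{C}(q)$-basis of $H_n(q)$. For $0\le k\le\binom n2$ put $\mathscr{Y}_{n,k}=\sum_{w\in\mathfrak{S}_n,\ \ell(w)=k}T_w$. For $z\in\mathbb{C}(q)$ and $1\le i\le n-1$ put $\mathscr{X}_i(z)=1+zT_i+z^2T_{i-1}T_i+\cdots+z^iT_1T_2\cdots T_i$. The shuffle element is $\mathscr{S}_n(z)=\mathscr{X}_{n-1}(z)\mathscr{X}_{n-2}(z)\cdots\mathscr{X}_1(z)$,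 and it satisfies $\mathscr{S}_n(z)=\sum_{k=0}^{\binom n2}z^k\mathscr{Y}_{n,k}$. *)

(* Defs.v *)
From HB Require Import structures.
From mathcomp Require Import all_boot all_order all_algebra all_fingroup.
From mathcomp Require Import boolp reals complex.
From mathcomp Require Import monalg.

Set Implicit Arguments.
Unset Strict Implicit.
Unset Printing Implicit Defensive.

Import GRing.Theory.
Local Open Scope ring_scope.

(* Throughout, the index i : 'I_n.-1 stands for the 1-based index i+1:
   s_1, ..., s_(n-1) and T_1, ..., T_(n-1) are indexed by 0, ..., n-2. *)

Section Length.
Variable n : nat.
Implicit Types (w : 'S_n) (i : 'I_n.-1).

Fact simple_lo_subproof i : (i < n)%N.
Proof. exact: leq_trans (ltn_ord i) (leq_pred n). Qed.

Fact simple_hi_subproof i : (i.+1 < n)%N.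
Proof. by rewrite -ltn_predRL. Qed.

Definition simple_transposition i : 'S_n :=
  tperm (Ordinal (simple_lo_subproof i)) (Ordinal (simple_hi_subproof i)).

(* In 'S_n, s * t maps x to t (s x); the opposite convention replaces w by w^-1,
   which changes neither the length nor the sums of T_w over a given length. *)
Definition word_perm (u : seq 'I_n.-1) : 'S_n :=
  (\prod_(i <- u) simple_transposition i)%g.

Definition has_word w k := [exists u : k.-tuple 'I_n.-1, word_perm u == w].

Lemma word_perm_cat u v : word_perm (u ++ v) = (word_perm u * word_perm v)%g.
Proof. by rewrite /word_perm big_cat. Qed.

Lemma tperm_word (k : nat) (x y : 'I_n) :
  y = (x + k)%N :> nat -> exists u, word_perm u = tperm x y.
Proof.
elim: k y => [|k IHk] y Dy.
  have ->: y = x by apply: val_inj; rewrite /= Dy addn0.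
  by exists [::]; rewrite /word_perm big_nil tperm1.
have lt_n : ((x + k).+1 < n)%N by rewrite -addnS -Dy.
pose z := Ordinal (ltnW lt_n).
have lt_i : (x + k < n.-1)%N by rewrite ltn_predRL.
pose i := Ordinal lt_i.
have Ds : simple_transposition i = tperm z y.
  by congr tperm; apply: val_inj => //=; rewrite Dy addnS.
have wi : word_perm [:: i] = tperm z y by rewrite /word_perm big_seq1.
case: (eqVneq x z) => [->|nxz]; first by exists [:: i].
have nxy : x != y by rewrite -val_eqE /= Dy -[X in X == _]addn0 eqn_add2l.
have [u Du] := IHk z erefl.
exists ([:: i] ++ u ++ [:: i]); rewrite !word_perm_cat wi Du.
rewrite -[X in (X * _)%g]tpermV -[LHS]/(tperm x z ^ tperm z y)%g tpermJ.
by rewrite tpermL tpermD // eq_sym.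
Qed.

Lemma has_word_ex w : exists k, has_word w k.
Proof.
suff [u <-] : exists u, word_perm u = w.
  by exists (size u); apply/existsP; exists (in_tuple u).
have [ts -> _] := prod_tpermP w.
elim: ts => [|[x y] ts [u Du]].
  by exists [::]; rewrite /word_perm !big_nil.
have [v Dv] : exists v, word_perm v = tperm x y.
  case/orP: (leq_total x y) => le_xy.
    by apply: (@tperm_word (y - x)); rewrite subnKC.
  by rewrite tpermC; apply: (@tperm_word (x - y)); rewrite subnKC.
by exists (v ++ u); rewrite big_cons word_perm_cat Dv Du.
Qed.

Definition coxeter_length w : nat := ex_minn (has_word_ex w).

Fact coxeter_length_word w :
  exists u : (coxeter_length w).-tuple 'I_n.-1, word_perm u == w.
Proof. by apply/existsP; rewrite /coxeter_length; case: ex_minnP. Qed.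

Definition reduced_word w : (coxeter_length w).-tuple 'I_n.-1 :=
  xchoose (coxeter_length_word w).

End Length.


Section AlgebraQuotient.
Variables (K : fieldType) (A : algType K) (rel : A -> Prop).
Implicit Types u v : A.

(* The two-sided ideal generated by rel. *)
Inductive in_ideal : A -> Prop :=
| InIdealRel r : rel r -> in_ideal r
| InIdeal0 : in_ideal 0
| InIdealD u v : in_ideal u -> in_ideal v -> in_ideal (u + v)
| InIdealM a u b : in_ideal u -> in_ideal (a * u * b).

Definition ideal_of : {pred A} := fun u => `[< in_ideal u >].

Lemma ideal_ofP u : reflect (in_ideal u) (ideal_of u).
Proof. exact: asboolP. Qed.

Lemma ideal_ofMl a u : ideal_of u -> ideal_of (a * u).
Proof.
by move=> /ideal_ofP Hu; apply/ideal_ofP; rewrite -[_ * _]mulr1; apply: InIdealM.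
Qed.

Lemma ideal_ofMr u b : ideal_of u -> ideal_of (u * b).
Proof.
by move=> /ideal_ofP Hu; apply/ideal_ofP; rewrite -[u]mul1r; apply: InIdealM.
Qed.

Fact ideal_of_zmod_closed : zmod_closed ideal_of.
Proof.
split=> [|u v Hu Hv]; first exact/ideal_ofP/InIdeal0.
apply/ideal_ofP/InIdealD; apply/ideal_ofP => //.
by rewrite -[v]mul1r -mulNr; apply: ideal_ofMl.
Qed.
HB.instance Definition _ := GRing.isZmodClosed.Build A ideal_of
  ideal_of_zmod_closed.

Definition alg_quot : Type := Quotient.quot (ideal_of : zmodClosed A).
HB.instance Definition _ := Choice.on alg_quot.
HB.instance Definition _ := GRing.Zmodule.on alg_quot.

Local Open Scope quotient_scope.

Definition quot_pi (u : A) : alg_quot :=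
  \pi_(Quotient.quot (ideal_of : zmodClosed A)) u.

Definition quot_repr (x : alg_quot) : A :=
  generic_quotient.repr (x : Quotient.quot (ideal_of : zmodClosed A)).

Lemma quot_reprK x : quot_pi (quot_repr x) = x.
Proof. exact: reprK. Qed.

Lemma quot_piP u v : reflect (quot_pi u = quot_pi v) (ideal_of (u - v)).
Proof.
rewrite -[ideal_of _]/(u - v \in (ideal_of : zmodClosed A)) Quotient.idealrBE.
exact: eqP.
Qed.

Lemma quot_pi_repr u : ideal_of (quot_repr (quot_pi u) - u).
Proof. by apply/quot_piP; rewrite quot_reprK. Qed.

Lemma quot_piB : {morph quot_pi : u v / u - v}.
Proof.
move=> u v; rewrite /quot_pi [LHS]Quotient.pi_add.
by congr (_ + _); apply: Quotient.pi_opp.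
Qed.
HB.instance Definition _ := GRing.isZmodMorphism.Build A alg_quot quot_pi quot_piB.

Definition quot_mul (x y : alg_quot) : alg_quot :=
  locked quot_pi (quot_repr x * quot_repr y).
Definition quot_scale (c : K) (x : alg_quot) : alg_quot :=
  locked quot_pi (c *: quot_repr x).

Lemma quot_mulE u v : quot_pi (u * v) = quot_mul (quot_pi u) (quot_pi v).
Proof.
rewrite /quot_mul -lock; apply/esym/quot_piP.
have Hu := quot_pi_repr u; have Hv := quot_pi_repr v.
set u' := quot_repr _ in Hu *; set v' := quot_repr _ in Hv *.
have -> : u' * v' - u * v = u' * (v' - v) + (u' - u) * v.
  by rewrite mulrBr mulrBl addrA subrK.
apply/ideal_ofP/InIdealD; apply/ideal_ofP; first exact: ideal_ofMl.
exact: ideal_ofMr.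
Qed.

Lemma quot_scaleE c u : quot_pi (c *: u) = quot_scale c (quot_pi u).
Proof.
rewrite /quot_scale -lock; apply/esym/quot_piP.
by rewrite -scalerBr -mulr_algl; apply/ideal_ofMl/quot_pi_repr.
Qed.

Fact quot_mulA : associative quot_mul.
Proof.
move=> x y z; rewrite -[x]quot_reprK -[y]quot_reprK -[z]quot_reprK.
by rewrite -!quot_mulE mulrA.
Qed.
Fact quot_mul1r : left_id (quot_pi 1) quot_mul.
Proof. by move=> x; rewrite -[x]quot_reprK -quot_mulE mul1r. Qed.
Fact quot_mulr1 : right_id (quot_pi 1) quot_mul.
Proof. by move=> x; rewrite -[x]quot_reprK -quot_mulE mulr1. Qed.
Fact quot_mulDl : left_distributive quot_mul +%R.
Proof.
move=> x y z; rewrite -[x]quot_reprK -[y]quot_reprK -[z]quot_reprK.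
by rewrite -raddfD -!quot_mulE -raddfD mulrDl.
Qed.
Fact quot_mulDr : right_distributive quot_mul +%R.
Proof.
move=> x y z; rewrite -[x]quot_reprK -[y]quot_reprK -[z]quot_reprK.
by rewrite -raddfD -!quot_mulE -raddfD mulrDr.
Qed.
HB.instance Definition _ := GRing.Zmodule_isPzRing.Build alg_quot
  quot_mulA quot_mul1r quot_mulr1 quot_mulDl quot_mulDr.

Fact quot_pi_monoid_morphism : monoid_morphism quot_pi.
Proof. by split=> // u v; rewrite quot_mulE. Qed.
HB.instance Definition _ := GRing.isMonoidMorphism.Build A alg_quot quot_pi
  quot_pi_monoid_morphism.

Fact quot_scaleA a b x : quot_scale a (quot_scale b x) = quot_scale (a * b) x.
Proof. by rewrite -[x]quot_reprK -!quot_scaleE scalerA. Qed.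
Fact quot_scale1r : left_id 1 quot_scale.
Proof. by move=> x; rewrite -[x]quot_reprK -quot_scaleE scale1r. Qed.
Fact quot_scaleDr : right_distributive quot_scale +%R.
Proof.
move=> c x y; rewrite -[x]quot_reprK -[y]quot_reprK.
by rewrite -raddfD -!quot_scaleE -raddfD scalerDr.
Qed.
Fact quot_scaleDl x : {morph quot_scale^~ x : a b / a + b}.
Proof.
by move=> a b; rewrite -[x]quot_reprK -!quot_scaleE -raddfD scalerDl.
Qed.
HB.instance Definition _ := GRing.Zmodule_isLmodule.Build K alg_quot
  quot_scaleA quot_scale1r quot_scaleDr quot_scaleDl.

Fact quot_pi_scalable : scalable quot_pi.
Proof. by move=> c u; rewrite quot_scaleE. Qed.
HB.instance Definition _ := GRing.isScalable.Build K A alg_quot *:%R quot_pi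
  quot_pi_scalable.

Fact quot_scaleAl (c : K) (x y : alg_quot) : c *: (x * y) = c *: x * y.
Proof.
rewrite -[x]quot_reprK -[y]quot_reprK.
by rewrite -rmorphM -!linearZ -rmorphM scalerAl.
Qed.

Fact quot_scaleAr (c : K) (x y : alg_quot) : c *: (x * y) = x * (c *: y).
Proof.
rewrite -[x]quot_reprK -[y]quot_reprK.
by rewrite -rmorphM -!linearZ -rmorphM scalerAr.
Qed.

Lemma quot_pi_rel r : rel r -> quot_pi r = 0.
Proof.
move=> Hr; rewrite -(raddf0 quot_pi); apply/quot_piP.
by rewrite subr0; apply/ideal_ofP/InIdealRel.
Qed.

Lemma in_ideal_ker (B : nzRingType) (f : {rmorphism A -> B}) :
  (forall r, rel r -> f r = 0) -> forall u, in_ideal u -> f u = 0.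
Proof.
move=> f0 u; elim=> {u} [r|| u v _ Hu _ Hv | a u b _ Hu].
- exact: f0.
- exact: rmorph0.
- by rewrite rmorphD Hu Hv addr0.
- by rewrite !rmorphM Hu mulr0 mul0r.
Qed.

Lemma quot_one_neq0 (B : nzRingType) (f : {rmorphism A -> B}) :
  (forall r, rel r -> f r = 0) -> (1 : alg_quot) != 0.
Proof.
move=> f0; apply/eqP; rewrite -[1](rmorph1 quot_pi) -(raddf0 quot_pi).
move=> /quot_piP/ideal_ofP; rewrite subr0 => /(in_ideal_ker f0)/eqP.
by rewrite rmorph1 oner_eq0.
Qed.

End AlgebraQuotient.

Section FreeAlgebra.
Variables (K : fieldType) (I : choiceType).

Definition free_alg : Type := {malg K[fmonom I]}.
HB.instance Definition _ := GRing.Lalgebra.on free_alg.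

Fact free_scaleAr (c : K) (u v : free_alg) : c *: (u * v) = u * (c *: v).
Proof.
have central : (c%:MP : free_alg) * u = u * c%:MP.
  transitivity (fgmul << c *g mone >> u); first exact: malgM_def.
  transitivity (fgmul u << c *g mone >>); last by symmetry; exact: malgM_def.
  rewrite fgmulUg fgmulgU; apply: eq_bigr => m _.
  by rewrite mulrC mul1m mulm1.
have E (w : free_alg) : c *: w = c%:MP * w by symmetry; exact: mul_malgC.
apply: etrans (E _) _; apply: etrans (mulrA _ _ _) _.
apply: etrans (congr1 ( *%R^~ v) central) _.
apply: etrans (esym (mulrA u _ v)) _.
by congr (u * _); apply: esym (E v).
Qed.
HB.instance Definition _ := GRing.Lalgebra_isAlgebra.Build K free_alg free_scaleAr.

Definition free_gen (i : I) : free_alg := << fmu i >>.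

End FreeAlgebra.

Section Hecke.
Variables (K : fieldType) (q : K) (n : nat).

Inductive hecke_relator (A : algType K) (t : 'I_n.-1 -> A) : A -> Prop :=
| HeckeQuadratic i : hecke_relator t (t i ^+ 2 - ((q - 1) *: t i + q%:A))
| HeckeCommute (i j : 'I_n.-1) : (i.+1 < j)%N || (j.+1 < i)%N ->
    hecke_relator t (t i * t j - t j * t i)
| HeckeBraid (i j : 'I_n.-1) : j = i.+1 :> nat ->
    hecke_relator t (t i * t j * t i - t j * t i * t j).

Definition hecke : Type := alg_quot (hecke_relator (@free_gen K 'I_n.-1)).
HB.instance Definition _ := GRing.PzRing.on hecke.
HB.instance Definition _ := GRing.Lmodule.on hecke.

(* H_n(q) is nontrivial: T_i |-> q is a one-dimensional representation. *)
Definition fmonom_index (m : fmonom 'I_n.-1) : K := q ^+ fdeg m.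

Fact fmonom_index_mmorphism : mmorphism fmonom_index.
Proof.
split=> [m1 m2|]; first by rewrite /fmonom_index fdegM exprD.
by rewrite /fmonom_index fdeg1.
Qed.
HB.instance Definition _ :=
  isMultiplicative.Build (fmonom 'I_n.-1) K fmonom_index fmonom_index_mmorphism.

Lemma index_relator (A : algType K) (t : 'I_n.-1 -> A) (f : {rmorphism A -> K}) :
    (forall c u, f (c *: u) = c * f u) -> (forall i, f (t i) = q) ->
  forall r, hecke_relator t r -> f r = 0.
Proof.
move=> fZ ft r []; [move=> i | move=> i j _ ..].
- by rewrite rmorphB rmorphXn rmorphD !fZ ft rmorph1 mulr1 mulrBl mul1r subrK expr2 subrr.
- by rewrite rmorphB !rmorphM !ft subrr.
- by rewrite rmorphB !rmorphM !ft subrr.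
Qed.

Fact hecke_one_neq0 : (1 : hecke) != 0.
Proof.
pose f : {rmorphism free_alg K 'I_n.-1 -> K} :=
  (mmap (idfun : K -> K) fmonom_index : {rmorphism {malg K[fmonom 'I_n.-1]} -> K}).
apply: (@quot_one_neq0 _ _ _ _ f); apply: index_relator => [c u|i].
  exact: mmapZ.
by rewrite /f /free_gen /= mmapU /fmonom_index fdegU expr1 mul1r.
Qed.
HB.instance Definition _ := GRing.PzSemiRing_isNonZero.Build hecke hecke_one_neq0.
HB.instance Definition _ := GRing.Lmodule_isLalgebra.Build K hecke (@quot_scaleAl _ _ _).
HB.instance Definition _ := GRing.Lalgebra_isAlgebra.Build K hecke (@quot_scaleAr _ _ _).

Definition hecke_pi : free_alg K 'I_n.-1 -> hecke := @quot_pi _ _ _.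
HB.instance Definition _ := GRing.isZmodMorphism.Build _ _ hecke_pi
  (@quot_piB _ _ _).
HB.instance Definition _ := GRing.isMonoidMorphism.Build _ _ hecke_pi
  (@quot_pi_monoid_morphism _ _ _).
HB.instance Definition _ := GRing.isScalable.Build _ _ _ _ hecke_pi
  (@quot_pi_scalable _ _ _).

Definition hecke_gen (i : 'I_n.-1) : hecke := hecke_pi (free_gen K i).

Lemma hecke_quadratic i : hecke_gen i ^+ 2 = (q - 1) *: hecke_gen i + q%:A.
Proof.
apply/subr0_eq; rewrite /hecke_gen -(rmorph1 hecke_pi) -(rmorphXn hecke_pi).
have Z c u : c *: hecke_pi u = hecke_pi (c *: u) by rewrite linearZ.
rewrite !Z -(rmorphD hecke_pi) -(rmorphB hecke_pi).
exact/quot_pi_rel/HeckeQuadratic.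
Qed.

Lemma hecke_commute (i j : 'I_n.-1) : (i.+1 < j)%N || (j.+1 < i)%N ->
  hecke_gen i * hecke_gen j = hecke_gen j * hecke_gen i.
Proof.
move=> Hij; apply/subr0_eq; rewrite /hecke_gen -!(rmorphM hecke_pi).
by rewrite -(rmorphB hecke_pi); apply/quot_pi_rel/HeckeCommute.
Qed.

Lemma hecke_braid (i j : 'I_n.-1) : j = i.+1 :> nat ->
  hecke_gen i * hecke_gen j * hecke_gen i =
  hecke_gen j * hecke_gen i * hecke_gen j.
Proof.
move=> Hij; apply/subr0_eq; rewrite /hecke_gen -!(rmorphM hecke_pi).
by rewrite -(rmorphB hecke_pi); apply/quot_pi_rel/HeckeBraid.
Qed.

(* By Matsumoto's theorem the chosen reduced word does not matter. *)
Definition hecke_T (w : 'S_n) : hecke := \prod_(i <- reduced_word w) hecke_gen i.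

Definition hecke_Y (k : nat) : hecke :=
  \sum_(w : 'S_n | coxeter_length w == k) hecke_T w.

(* hecke_X z i is X_(i+1)(z); its k-th term is the product of the k generators
   ending with the one of index i, in increasing order. *)
Definition hecke_X (z : K) (i : 'I_n.-1) : hecke :=
  \sum_(k < i.+2) z ^+ k *: \prod_(j < n.-1 | (i.+1 - k <= j <= i)%N) hecke_gen j.

Definition shuffle_elt (z : K) : hecke :=
  \prod_(i < n.-1) hecke_X z (rev_ord i).

End Hecke.

(* C(q), with C = R[i]. *)
Definition Cq (R : realType) : fieldType := {fraction {poly R[i]}}.
Definition Cq_indet (R : realType) : Cq R := tofrac 'X.

(* Main.v *)
(* Y_1 and Y_2 already fail to commute.  In the Burau representation
   T_i |-> q - r_i, where r_i is a rank one matrix with r_i^2 = (q + 1) r_i,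
   r_i r_j r_i = q r_i for |i - j| = 1 and r_i r_j = 0 for |i - j| > 1.  Hence, with
   R = \sum_i r_i, Y_1 is a scalar minus R, and Y_2 is a scalar plus a polynomial
   in R minus q D, where D = \sum_i d_i r_i and d_i counts the occurrences of T_i
   in the products making up Y_2.  So [Y_1, Y_2] = q [R, D], which is nonzero
   because d_0 <> d_1 as soon as there are three generators.

   The coefficients of z and z^2 in S(z) are Y_1 and Y_2; since C(q) is infinite,
   if all S(z), S(z') commuted, so would these coefficients. *)

Require Import Defs.
From HB Require Import structures.
From mathcomp Require Import all_boot all_order all_algebra all_fingroup.
From mathcomp Require Import boolp reals complex.
From mathcomp Require Import monalg.
From mathcomp Require Import ring zify.

Set Implicit Arguments.
Unset Strict Implicit.
Unset Printing Implicit Defensive.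

Import GRing.Theory.
Local Open Scope ring_scope.

(** * The universal property of the Hecke algebra *)

Section HeckeLift.
Variables (K : fieldType) (q : K) (n : nat) (B : algType K) (t : 'I_n.-1 -> B).

Definition fmonom_eval (m : fmonom 'I_n.-1) : B := \prod_(i <- m) t i.

Fact fmonom_eval_mmorphism : mmorphism fmonom_eval.
Proof.
by split=> [m1 m2|]; rewrite /fmonom_eval ?fmM ?big_cat // fm1 big_nil.
Qed.
HB.instance Definition _ :=
  isMultiplicative.Build (fmonom 'I_n.-1) B fmonom_eval fmonom_eval_mmorphism.

Definition free_eval : free_alg K 'I_n.-1 -> B :=
  mmap (in_alg B : {rmorphism K -> B}) fmonom_eval.

Fact free_eval_zmod_morphism : zmod_morphism free_eval.
Proof. exact: mmapB. Qed.
HB.instance Definition _ := GRing.isZmodMorphism.Build (free_alg K 'I_n.-1) B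
  free_eval free_eval_zmod_morphism.

Fact free_eval_monoid_morphism : monoid_morphism free_eval.
Proof.
have [fM f1] : multiplicative free_eval.
  (* With a noncommutative target, multiplicativity rests on the images of the scalars being central
     in [B]. *)
  apply: commr_mmap_is_multiplicative => g m m'; rewrite /GRing.comm.
  by rewrite mulr_algl mulr_algr.
by split.
Qed.
HB.instance Definition _ := GRing.isMonoidMorphism.Build (free_alg K 'I_n.-1) B
  free_eval free_eval_monoid_morphism.

Lemma free_eval_gen i : free_eval (free_gen K i) = t i.
Proof.
by rewrite /free_eval /free_gen mmapU /= scale1r mul1r /fmonom_eval fmU big_seq1.
Qed.

Lemma free_evalZ : scalable free_eval.
Proof.
move=> c u; rewrite -[RHS]mulr_algl.
exact: (@mmapZ _ _ _ (in_alg B : {rmorphism K -> B}) fmonom_eval).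
Qed.

Hypothesis t_quadratic : forall i, t i ^+ 2 = (q - 1) *: t i + q%:A.
Hypothesis t_commute : forall i j : 'I_n.-1,
  (i.+1 < j)%N || (j.+1 < i)%N -> t i * t j = t j * t i.
Hypothesis t_braid : forall i j : 'I_n.-1,
  j = i.+1 :> nat -> t i * t j * t i = t j * t i * t j.

Lemma morph_hecke_relator (A : algType K) (g : 'I_n.-1 -> A)
    (f : {rmorphism A -> B}) :
    (forall c u, f (c *: u) = c *: f u) -> (forall i, f (g i) = t i) ->
  forall r, hecke_relator q g r -> f r = 0.
Proof.
move=> fZ fg r [] => [i|i j ij|i j ij].
- by rewrite rmorphB rmorphXn rmorphD !fZ fg rmorph1 t_quadratic subrr.
- by rewrite rmorphB !rmorphM !fg t_commute ?subrr.
- by rewrite rmorphB !rmorphM !fg t_braid ?subrr.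
Qed.

Lemma free_eval_relator r :
  hecke_relator q (@free_gen K 'I_n.-1) r -> free_eval r = 0.
Proof.
exact: (morph_hecke_relator (f := free_eval) free_evalZ free_eval_gen).
Qed.

Definition hecke_lift (x : hecke q n) : B := free_eval (quot_repr x).

(** Two representatives of a class differ by an element of the ideal, which [free_eval] kills; so
    the choice made by [quot_repr] does not affect [hecke_lift]. *)
Lemma hecke_lift_pi u : hecke_lift (hecke_pi q u) = free_eval u.
Proof.
apply/subr0_eq; rewrite -rmorphB.
apply: (in_ideal_ker free_eval_relator); apply/ideal_ofP.
exact: quot_pi_repr.
Qed.

Lemma hecke_lift_gen i : hecke_lift (hecke_gen q i) = t i.
Proof. by rewrite hecke_lift_pi free_eval_gen. Qed.

Lemma hecke_piK (x : hecke q n) : hecke_pi q (quot_repr x) = x.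
Proof. exact: quot_reprK. Qed.

Lemma hecke_liftD : {morph hecke_lift : x y / x + y}.
Proof.
move=> x y; rewrite -[x]hecke_piK -[y]hecke_piK -rmorphD.
by rewrite !hecke_lift_pi rmorphD.
Qed.

Lemma hecke_liftM : {morph hecke_lift : x y / x * y}.
Proof.
move=> x y; rewrite -[x]hecke_piK -[y]hecke_piK -rmorphM.
by rewrite !hecke_lift_pi rmorphM.
Qed.

Lemma hecke_liftZ c x : hecke_lift (c *: x) = c *: hecke_lift x.
Proof.
by rewrite -[x]hecke_piK -linearZ !hecke_lift_pi free_evalZ.
Qed.

Lemma hecke_lift1 : hecke_lift 1 = 1.
Proof. by rewrite -(rmorph1 (@hecke_pi _ q n)) hecke_lift_pi rmorph1. Qed.

Lemma hecke_lift_exists : exists f : {lrmorphism hecke q n -> B},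
  forall i, f (hecke_gen q i) = t i.
Proof.
have fN : {morph hecke_lift : x / - x}.
  by move=> x; rewrite -scaleN1r hecke_liftZ scaleN1r.
have fB : zmod_morphism hecke_lift by move=> x y; rewrite hecke_liftD fN.
have fM : monoid_morphism hecke_lift by split; [exact: hecke_lift1|exact: hecke_liftM].
pose m1 := GRing.isZmodMorphism.Build _ _ hecke_lift fB.
pose m2 := GRing.isMonoidMorphism.Build _ _ hecke_lift fM.
pose m3 := GRing.isScalable.Build _ _ _ _ hecke_lift hecke_liftZ.
pose f : {lrmorphism hecke q n -> B} :=
  HB.pack hecke_lift m1 m2 m3.
by exists f => i; apply: hecke_lift_gen.
Qed.

End HeckeLift.

(** * The Burau representation through rank one matrices *)

Section Burau.
Variables (K : fieldType) (q : K) (N : nat).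
Implicit Types i j : 'I_N.

(** These are the column e_i - e_(i+1) and the row q e_i - e_(i+1), with outer product
    [burau_refl i]. On the coordinates i, i+1, [burau i] is then the unreduced Burau block with rows
    (0, 1) and (q, q - 1); elsewhere it is q. *)
Definition burau_form (i a : nat) : K := (a == i)%:R - (a == i.+1)%:R.
Definition burau_root (i a : nat) : K := q * (a == i)%:R - (a == i.+1)%:R.
Definition burau_refl i : 'M[K]_N.+1 :=
  \matrix_(a, b) (burau_form i a * burau_root i b).
(** The row of i applied to the column of j: the scalar to which products of rank one matrices
    reduce. *)
Definition burau_pairing (i j : nat) : K :=
  (q + 1) * (i == j)%:R - q * (i == j.+1)%:R - (i.+1 == j)%:R.

Lemma sum_natpick (f : nat -> K) k : (k < N.+1)%N ->
  \sum_(c < N.+1) (c == k :> nat)%:R * f c = f k.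
Proof.
move=> ltk; rewrite (bigD1 (Ordinal ltk)) //= eqxx mul1r big1 ?addr0 // => c.
by rewrite -val_eqE /= => /negbTE->; rewrite mul0r.
Qed.

Lemma burau_pairingE i j :
  \sum_(c < N.+1) burau_root i c * burau_form j c = burau_pairing i j.
Proof.
have lti := ltn_ord i.
have E (c : 'I_N.+1) : burau_root i c * burau_form j c =
    q * ((c == i :> nat)%:R * burau_form j c)
    - (c == i.+1 :> nat)%:R * burau_form j c.
  by rewrite /burau_root; ring.
under eq_bigr do rewrite E.
rewrite sumrB -mulr_sumr !sum_natpick ?ltnS // 1?ltnW //.
by rewrite /burau_form /burau_pairing eqSS; ring.
Qed.

Lemma burau_reflM i j (a b : 'I_N.+1) :
  (burau_refl i * burau_refl j) a b =
  burau_form i a * burau_pairing i j * burau_root j b.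
Proof.
rewrite mxE -burau_pairingE mulr_sumr mulr_suml; apply: eq_bigr => c _.
by rewrite !mxE; ring.
Qed.

Lemma burau_refl_sq i : burau_refl i * burau_refl i = (q + 1) *: burau_refl i.
Proof.
apply/matrixP=> a b; rewrite burau_reflM !mxE /burau_pairing eqxx.
by rewrite (ltn_eqF (ltnSn i)) (gtn_eqF (ltnSn i)) !(mulr0n, mulr1n); ring.
Qed.

Lemma burau_refl_far i j : (i.+1 < j)%N || (j.+1 < i)%N ->
  burau_refl i * burau_refl j = 0.
Proof.
move=> ij; apply/matrixP=> a b; rewrite burau_reflM !mxE /burau_pairing.
have [-> [-> ->]] : (i == j :> nat) = false /\
  (i == j.+1 :> nat) = false /\ (i.+1 == j :> nat) = false by lia.
by rewrite !(mulr0n, mulr1n); ring.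
Qed.

Lemma burau_pairing_near k : burau_pairing k k.+1 * burau_pairing k.+1 k = q.
Proof.
rewrite /burau_pairing !eqxx (ltn_eqF (ltnSn k)) (gtn_eqF (ltnSn k)).
by rewrite ltn_eqF // gtn_eqF // !(mulr0n, mulr1n); ring.
Qed.

Lemma burau_refl_near i j : (j == i.+1 :> nat) || (i == j.+1 :> nat) ->
  burau_refl i * burau_refl j * burau_refl i = q *: burau_refl i.
Proof.
move=> ij; have ij' : burau_pairing i j * burau_pairing j i = q.
  by case/orP: ij => /eqP->; rewrite ?burau_pairing_near // mulrC burau_pairing_near.
(* The scalar q is traded for the two pairings, and one of them is unfolded into a sum so that both
   sides match term by term. *)
apply/matrixP=> a b; rewrite !mxE -[q in RHS]ij' -(burau_pairingE j i).
rewrite mulr_sumr mulr_suml; apply: eq_bigr => c _.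
by rewrite burau_reflM !mxE; ring.
Qed.

Definition burau i : 'M[K]_N.+1 := q%:A - burau_refl i.

Lemma burau_mulE i j : burau i * burau j =
  (q ^+ 2)%:A - q *: burau_refl i - q *: burau_refl j
  + burau_refl i * burau_refl j.
Proof.
rewrite /burau; move: (burau_refl i) (burau_refl j) => x y.
rewrite mulrBl !mulrBr !mulr_algl mulr_algr; move: (x * y) => z.
by apply/matrixP=> a b; rewrite !mxE; ring.
Qed.

Lemma burau_quadratic i : burau i ^+ 2 = (q - 1) *: burau i + q%:A.
Proof.
rewrite expr2 burau_mulE burau_refl_sq /burau.
by apply/matrixP=> a b; rewrite !mxE; ring.
Qed.

Lemma burau_commute i j : (i.+1 < j)%N || (j.+1 < i)%N ->
  burau i * burau j = burau j * burau i.
Proof.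
move=> ij; rewrite !burau_mulE !burau_refl_far // 1?orbC //.
by rewrite !addr0 addrAC.
Qed.

Lemma burau_braid i j : j = i.+1 :> nat ->
  burau i * burau j * burau i = burau j * burau i * burau j.
Proof.
move=> ij; have := @burau_refl_near i j; have := @burau_refl_near j i.
rewrite ij eqxx orbT /= => /(_ isT) near1 /(_ isT) near2.
rewrite !burau_mulE /burau !(mulrDl, mulrBl) !mulrBr.
rewrite !mulr_algl !mulr_algr !mulNr -!scalerAl near1 near2 !burau_refl_sq.
(* Squares and words of the form xyx or yxy have been reduced, so the identity is now linear in x,
   y, xy and yx. *)
move: (burau_refl i) (burau_refl j) => x y.
move: (x * y) (y * x) => z t.
by apply/matrixP=> a b; rewrite !mxE; ring.
Qed.
End Burau.

(* Each element of length 2 is s_i s_j for exactly one canonical pair (i, j). *)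
Definition canonical_pair (i j : nat) := (j < i)%N || (j == i.+1).

(** A generator occurs once with each generator it commutes with and twice with each neighbour.
    Index 0 has one neighbour; index 1 has two once N > 2. *)
Lemma canonical_pair_degree N : (2 < N)%N ->
  (\sum_(j < N) (canonical_pair 1 j + canonical_pair j 1) =
   (\sum_(j < N) (canonical_pair 0 j + canonical_pair j 0)).+1)%N.
Proof.
case: N => [|[|[|k]]] // _; rewrite !big_ord_recl /=.
by rewrite /canonical_pair /=; lia.
Qed.

(** Polynomials in [x] commute with [a%:A - x], so only the term [c *: y] contributes. *)
Lemma commutator_quadratic (K : fieldType) (A : algType K) (a b c d : K) (x y : A) :
  (a%:A - x) * (b%:A - c *: y + x * x - d *: x)
  - (b%:A - c *: y + x * x - d *: x) * (a%:A - x) = c *: (x * y - y * x).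
Proof.
have commE z : (a%:A - x) * z - z * (a%:A - x) = z * x - x * z.
  by rewrite mulrBl mulrBr mulr_algl mulr_algr opprB addrC addrA subrK.
pose u := b%:A + x * x - d *: x.
have -> : b%:A - c *: y + x * x - d *: x = u - c *: y.
  by rewrite /u [RHS]addrAC [X in _ = X - _]addrAC.
have ux : u * x = x * u.
  rewrite /u !(mulrBl, mulrDl, mulrBr, mulrDr) mulr_algl mulr_algr.
  by rewrite -scalerAl -scalerAr mulrA.
rewrite commE mulrBl mulrBr ux -scalerAl -scalerAr opprB addrC addrA subrK.
by rewrite scalerBr.
Qed.

(** * Noncommutativity of the Burau images of Y_1 and Y_2 *)

Section BurauNoncommuting.
Variables (K : fieldType) (q : K) (N : nat).
Implicit Types i j : 'I_N.

Let r := @burau_refl K q N.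
Let R := \sum_i r i.
Let deg i := (\sum_(j < N) (canonical_pair i j + canonical_pair j i))%N.
Let D := \sum_i (deg i)%:R *: r i.

Lemma burau_sum1 : \sum_i burau q i = (N%:R * q)%:A - R.
Proof.
by rewrite sumrB sumr_const card_ord -scaler_nat scalerA.
Qed.

Lemma burau_sum2 : exists c : K,
  \sum_(i < N) \sum_(j < N | canonical_pair i j) burau q i * burau q j =
  c%:A - q *: D + R * R - (q + 1) *: R.
Proof.
exists (\sum_(i < N) \sum_(j < N | canonical_pair i j) q ^+ 2).
(* The diagonal of [R * R] gives [(q + 1) *: R]. Off the diagonal, a pair that is not canonical has
   j > i + 1, where [r i * r j] vanishes. *)
have -> : R * R = (q + 1) *: R + \sum_(i < N) \sum_(j < N | canonical_pair i j) r i * r j.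
  rewrite /R mulr_suml scaler_sumr -big_split /=; apply: eq_bigr => i _.
  rewrite mulr_sumr (bigD1 i) //= burau_refl_sq; congr (_ + _).
  rewrite big_mkcond [RHS]big_mkcond /=; apply: eq_bigr => j _.
  rewrite -val_eqE /= /canonical_pair.
  have [ij|ij] := boolP ((i.+1 < j)%N || (j.+1 < i)%N).
    by rewrite burau_refl_far // !if_same.
  by have -> : (j != i :> nat) = (j < i)%N || (j == i.+1 :> nat) by lia.
(* The terms linear in the [r i] from each product of two Burau matrices are collected, an index
   being counted both as left and as right factor. *)
have -> : D = \sum_(i < N) \sum_(j < N | canonical_pair i j) (r i + r j).
  rewrite [RHS](eq_bigr (fun i => \sum_(j < N) ((canonical_pair i j)%:R *: r i
     + (canonical_pair i j)%:R *: r j))) => [|i _]; last first.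
    rewrite big_mkcond; apply: eq_bigr => j _ /=.
    by case: canonical_pair; rewrite ?scale1r ?scale0r ?addr0.
  rewrite (eq_bigr _ (fun i _ => big_split _ _ _ _ _)) big_split /=.
  rewrite [X in _ + X]exchange_big -big_split /=; apply: eq_bigr => i _.
  by rewrite -!scaler_suml -scalerDl natr_sum -big_split /=; congr (_ *: _);
    apply: eq_bigr => j _; rewrite natrD.
rewrite addrA [X in X - _]addrAC addrK scaler_suml scaler_sumr.
rewrite -sumrB -big_split /=; apply: eq_bigr => i _.
rewrite scaler_suml scaler_sumr -sumrB -big_split /=; apply: eq_bigr => j _.
by rewrite burau_mulE scalerDr opprD !addrA.
Qed.

(** Row 0 forces i = 0 and column 2 forces j to be 1 or 2; j = 2 is excluded by [r_0 r_2 = 0], and j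
    = 1 gives 1 * (-1) * (-1). *)
Lemma burau_reflM02 (a b : 'I_N.+1) i j : a = 0%N :> nat -> b = 2%N :> nat ->
  (r i * r j) a b = ((i == 0%N :> nat) && (j == 1%N :> nat))%:R.
Proof.
move=> a0 b2; rewrite burau_reflM /burau_form /burau_root /burau_pairing a0 b2.
case: (i : nat) => [|k] /=; last by rewrite !(mulr0n, subrr, mul0r).
by case: (j : nat) => [|[|[|k']]] /=; rewrite !(mulr0n, mulr1n) //; ring.
Qed.

Lemma burau_noncommuting : q != 0 -> (2 < N)%N ->
  exists a b : 'I_N.+1,
  let Y1 := \sum_i burau q i in
  let Y2 := \sum_(i < N) \sum_(j < N | canonical_pair i j) burau q i * burau q j in
  (Y1 * Y2 - Y2 * Y1) a b != 0.
Proof.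
move=> q0 N3; have N3' : (2 < N.+1)%N by apply: leqW.
exists ord0, (Ordinal N3') => /=.
have [e ->] := burau_sum2; rewrite burau_sum1.
set a := ord0; set b := Ordinal N3'.
have -> : (((N%:R * q)%:A - R) * (e%:A - q *: D + R * R - (q + 1) *: R)
   - (e%:A - q *: D + R * R - (q + 1) *: R) * ((N%:R * q)%:A - R))
   = q *: (R * D - D * R).
  exact: commutator_quadratic.
rewrite mxE mulf_neq0 //.
pose o0 := Ordinal (ltnW (ltnW N3)); pose o1 := Ordinal (ltnW N3).
have entry (c : 'I_N -> 'I_N -> K) :
    (\sum_i \sum_j c i j *: (r i * r j)) a b = c o0 o1.
  rewrite summxE (bigD1 o0) //= [X in _ + X]big1 => [|i i0].
    rewrite summxE (bigD1 o1) //= [X in _ + X + _]big1 => [|j j1].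
      by rewrite mxE burau_reflM02 // mulr1 !addr0.
    by rewrite mxE burau_reflM02 //= -[(j == _ :> nat)]/(j == o1) (negPf j1) mulr0.
  rewrite summxE big1 // => j _.
  by rewrite mxE burau_reflM02 //= -[(i == _ :> nat)]/(i == o0) (negPf i0) mulr0.
(* The product [r i * r j] has coefficient [deg j] in [R * D] and [deg i] in [D * R], so the (0, 2)
   entry of the commutator is [deg o1] minus [deg o0]. *)
have -> : R * D = \sum_i \sum_j (deg j)%:R *: (r i * r j).
  rewrite mulr_suml; apply: eq_bigr => i _; rewrite mulr_sumr.
  by apply: eq_bigr => j _; rewrite -scalerAr.
have -> : D * R = \sum_i \sum_j (deg i)%:R *: (r i * r j).
  rewrite mulr_suml; apply: eq_bigr => i _; rewrite mulr_sumr.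
  by apply: eq_bigr => j _; rewrite -scalerAl.
rewrite mxE [X in _ + X]mxE !entry.
suff -> : deg o1 = (deg o0).+1 by rewrite -natrB // subSnn oner_eq0.
exact: canonical_pair_degree.
Qed.
End BurauNoncommuting.

(** * Permutations of length one and two *)

Definition swap_adjacent (i x : nat) : nat :=
  if x == i then i.+1 else if x == i.+1 then i else x.

Variant swap_adjacent_spec (i x : nat) : nat -> Prop :=
| SwapLo of x = i : swap_adjacent_spec i x i.+1
| SwapHi of x = i.+1 : swap_adjacent_spec i x i
| SwapFix of x <> i & x <> i.+1 : swap_adjacent_spec i x x.

Lemma swap_adjacentP i x : swap_adjacent_spec i x (swap_adjacent i x).
Proof.
rewrite /swap_adjacent; case: eqP => [->|?]; first exact: SwapLo.
by case: eqP => [->|?]; [apply: SwapHi|apply: SwapFix].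
Qed.

(* The descents of s_i s_j recover the factors, up to commutation. *)
Lemma swap_adjacent2_descent (i j x : nat) : i != j ->
  (swap_adjacent j (swap_adjacent i x.+1) < swap_adjacent j (swap_adjacent i x))%N =
  (x == i) || (x == j) && ((i.+1 < j)%N || (j.+1 < i)%N).
Proof.
move=> ij; case: (swap_adjacentP i x) => ?; case: (swap_adjacentP i x.+1) => ?;
  by do ?[case: (swap_adjacentP j) => ?]; lia.
Qed.

Section ShortLength.
Variable n : nat.
Implicit Types (i j k l : 'I_n.-1) (w : 'S_n).
Local Notation s := (@simple_transposition n).

(** Passing to natural numbers makes identities between simple transpositions a matter of linear
    arithmetic. *)
Lemma simple_transpositionE i (x : 'I_n) : s i x = swap_adjacent i x :> nat.
Proof.
rewrite /swap_adjacent permE /= -!val_eqE /=.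
by case: ifP => // _; case: ifP. Qed.

Lemma simple_transposition_inj : injective s.
Proof.
move=> i j eq_s; apply/val_inj/eqP.
pose x := Ordinal (simple_lo_subproof i).
have := congr1 (fun w : 'S_n => val (w x)) eq_s.
rewrite /= !simple_transpositionE /=.
by case: (swap_adjacentP i i) => ?; case: (swap_adjacentP j i) => ?; lia.
Qed.

Lemma simple_transposition_sq i : (s i * s i = 1)%g.
Proof. exact: tperm2. Qed.

Lemma simple_transposition_comm i j : (i.+1 < j)%N || (j.+1 < i)%N ->
  (s i * s j = s j * s i)%g.
Proof.
move=> ij; apply/permP => x; apply: val_inj.
rewrite /= !permM !simple_transpositionE.
by case: (swap_adjacentP i x) => ?; case: (swap_adjacentP j x) => ?;
  do ?[case: (swap_adjacentP i) => ?]; do ?[case: (swap_adjacentP j) => ?]; lia.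
Qed.

(** The index k is a descent of s_k s_l, hence of s_i s_j, which leaves k = i, or k = j with
    commuting factors; cancelling s_k then determines l. *)
Lemma simple_transposition_prod_inj i j k l : i != j ->
  (s i * s j = s k * s l)%g ->
  (k = i /\ l = j) \/ [/\ k = j, l = i & (i.+1 < j)%N || (j.+1 < i)%N].
Proof.
move=> ij eq_s.
have kl : k != l.
  apply: contraNneq ij => kl; move: eq_s; rewrite kl simple_transposition_sq.
  by move=> /(canRL (mulgK _)); rewrite mul1g tpermV => /simple_transposition_inj->.
have /esym : (k == i) || (k == j) && ((i.+1 < j)%N || (j.+1 < i)%N).
  rewrite -[k == i]/(k == i :> nat) -[k == j]/(k == j :> nat).
  rewrite -swap_adjacent2_descent //.
  pose x := Ordinal (simple_lo_subproof k); pose y := Ordinal (simple_hi_subproof k).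
  have E z := congr1 (fun w : 'S_n => val (w z)) eq_s.
  have := E x; have := E y; rewrite /= !permM !simple_transpositionE /= => -> ->.
  by rewrite swap_adjacent2_descent // eqxx.
move/esym/orP=> [/eqP ki|/andP[/eqP kj far]].
  by left; split=> //; move: eq_s; rewrite ki => /mulgI/simple_transposition_inj.
right; split=> //; move: eq_s; rewrite simple_transposition_comm // kj.
by move/mulgI/simple_transposition_inj.
Qed.

Lemma coxeter_length_le w (m : nat) : has_word w m -> (coxeter_length w <= m)%N.
Proof. by rewrite /coxeter_length; case: ex_minnP => p _; apply. Qed.

Lemma odd_word_perm (u : seq 'I_n.-1) : odd_perm (word_perm u) = odd (size u).
Proof.
elim: u => [|i u IHu]; first by rewrite /word_perm big_nil odd_perm1.
rewrite /word_perm big_cons odd_permM odd_tperm [X in _ (+) X]IHu /=.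
by rewrite -val_eqE /= (ltn_eqF (ltnSn i)).
Qed.

Lemma reduced_wordP w : word_perm (reduced_word w) = w.
Proof. exact/eqP/(xchooseP (coxeter_length_word w)). Qed.

Lemma odd_coxeter_length w : odd (coxeter_length w) = odd_perm w.
Proof. by rewrite -{2}[w]reduced_wordP odd_word_perm size_tuple. Qed.

Lemma coxeter_length0 w : coxeter_length w = 0%N -> w = 1%g.
Proof.
move=> w0; rewrite -[w]reduced_wordP; move: (reduced_word w); rewrite w0.
by move=> u; rewrite [u]tuple0 /word_perm big_nil.
Qed.

Lemma word_perm1 i : word_perm [:: i] = s i.
Proof. by rewrite /word_perm big_seq1. Qed.

Lemma word_perm2 i j : word_perm [:: i; j] = (s i * s j)%g.
Proof. by rewrite /word_perm big_cons big_seq1. Qed.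

Lemma coxeter_length1 i : coxeter_length (s i) = 1%N.
Proof.
have le1 : (coxeter_length (s i) <= 1)%N.
  by apply: coxeter_length_le; apply/existsP; exists [tuple i]; rewrite word_perm1.
have := odd_coxeter_length (s i).
rewrite -[in odd_perm _]word_perm1 odd_word_perm /=.
by case: coxeter_length le1 => [|[]].
Qed.

(** The length is at most 2 and even by the sign; length 0 would give s_i = s_j. *)
Lemma coxeter_length2 i j : i != j -> coxeter_length (s i * s j)%g = 2%N.
Proof.
move=> ij; have le2 : (coxeter_length (s i * s j)%g <= 2)%N.
  apply: coxeter_length_le; apply/existsP.
  by exists [tuple i; j]; rewrite word_perm2.
have := odd_coxeter_length (s i * s j)%g; have := @coxeter_length0 (s i * s j)%g.
rewrite -[in odd_perm _]word_perm2 odd_word_perm /=.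
case: coxeter_length le2 => [|[|[|m]]] //= _.
move=> /(_ erefl) /(canRL (mulgK _)); rewrite mul1g tpermV.
by move/simple_transposition_inj/eqP; rewrite (negPf ij).
Qed.

Lemma reduced_word1 i : reduced_word (s i) = [:: i] :> seq _.
Proof.
have sz : size (reduced_word (s i)) = 1%N by rewrite size_tuple coxeter_length1.
move: sz (reduced_wordP (s i)).
case: (tval (reduced_word (s i))) => [|j [|? ?]] // _.
by rewrite word_perm1 => /simple_transposition_inj->.
Qed.

(** The chosen reduced word may list the factors in either order, but the reverse order arises only
    when they commute. *)
Lemma reduced_word2 i j : i != j ->
  reduced_word (s i * s j)%g = [:: i; j] :> seq _ \/
  reduced_word (s i * s j)%g = [:: j; i] :> seq _ /\
  ((i.+1 < j)%N || (j.+1 < i)%N).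
Proof.
move=> ij; have sz : size (reduced_word (s i * s j)%g) = 2%N.
  by rewrite size_tuple coxeter_length2.
move: sz (reduced_wordP (s i * s j)%g).
case: (tval (reduced_word (s i * s j)%g)) => [|k [|l [|? ?]]] // _.
rewrite word_perm2 => /esym/(simple_transposition_prod_inj ij).
by case=> [[-> ->]|[-> -> far]]; [left|right].
Qed.

Lemma coxeter_length1P w : coxeter_length w = 1%N -> exists i, w = s i.
Proof.
move=> w1; have sz : size (reduced_word w) = 1%N by rewrite size_tuple.
move: sz (reduced_wordP w); case: (tval (reduced_word w)) => [|i [|? ?]] // _.
by rewrite word_perm1 => <-; exists i.
Qed.

Lemma coxeter_length2P w : coxeter_length w = 2%N ->
  exists i j, canonical_pair i j /\ w = (s i * s j)%g.
Proof.
move=> w2; have sz : size (reduced_word w) = 2%N by rewrite size_tuple.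
move: sz (reduced_wordP w).
case: (tval (reduced_word w)) => [|i [|j [|? ?]]] // _; rewrite word_perm2 => Dw.
have ij : i != j :> nat.
  apply: contra_eq_neq w2 => /val_inj ij.
  have w1 : has_word w 0.
    by apply/existsP; exists [tuple];
      rewrite -Dw ij simple_transposition_sq /word_perm big_nil.
  by have := coxeter_length_le w1; case: coxeter_length.
have [cij|ncij] := boolP (canonical_pair i j); first by exists i, j.
(* Here j > i + 1, so the factors commute and the reversed pair is canonical. *)
have [cji far] : canonical_pair j i /\ ((i.+1 < j)%N || (j.+1 < i)%N).
  by move: ncij; rewrite /canonical_pair; lia.
by exists j, i; rewrite -simple_transposition_comm.
Qed.
End ShortLength.

(** * Y_1 and Y_2 in terms of the generators *)

Section HeckeShortSums.
Variables (K : fieldType) (q : K) (n : nat).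

Lemma hecke_Y1 : hecke_Y q n 1 = \sum_i hecke_gen q i.
Proof.
rewrite /hecke_Y (eq_bigl (mem [set simple_transposition i | i : 'I_n.-1])) => [|w].
  rewrite big_imset /= => [|i j _ _]; last exact: simple_transposition_inj.
  by apply: eq_big => // i _; rewrite /hecke_T reduced_word1 big_seq1.
apply/eqP/imsetP => [/coxeter_length1P[i ->]|[i _ ->]]; first by exists i.
exact: coxeter_length1.
Qed.

Lemma hecke_Y2 : hecke_Y q n 2 =
  \sum_(i < n.-1) \sum_(j < n.-1 | canonical_pair i j) hecke_gen q i * hecke_gen q j.
Proof.
pose h (p : 'I_n.-1 * 'I_n.-1) := (simple_transposition p.1 * simple_transposition p.2)%g.
pose P := [set p : 'I_n.-1 * 'I_n.-1 | canonical_pair p.1 p.2].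
have neq i j : canonical_pair i j -> i != j by rewrite /canonical_pair; lia.
rewrite /hecke_Y (eq_bigl (mem (h @: P))) => [|w].
  rewrite big_imset /= => [|[i j] [k l]].
    rewrite pair_big_dep /=; apply: eq_big => [[i j]|[i j]]; rewrite inE //= => cij.
    rewrite /hecke_T; have [->|[-> far]] := reduced_word2 (neq _ _ cij).
      by rewrite big_cons big_seq1.
    by rewrite big_cons big_seq1 hecke_commute // orbC.
  (* Two canonical pairs with the same product coincide, since the reverse of a far canonical pair
     is not canonical. *)
  rewrite !inE /h /= => cij ckl.
  case/(simple_transposition_prod_inj (neq _ _ cij)) => [[-> ->] //|].
  by case=> kj li; move: cij ckl; rewrite kj li /canonical_pair; lia.
apply/eqP/imsetP => [/coxeter_length2P[i [j [cij ->]]]|[[i j]]].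
  by exists (i, j); rewrite ?inE.
by rewrite inE => cij ->; rewrite coxeter_length2 // neq.
Qed.
End HeckeShortSums.

(** * Low coefficients of products and comparison of coefficients *)

Section PolynomialProducts.

Lemma coef_prod_low (A : nzRingType) (m : nat) (F : 'I_m -> {poly A}) :
  (forall i, (F i)`_0 = 1) ->
  [/\ (\prod_i F i)`_0 = 1, (\prod_i F i)`_1 = \sum_i (F i)`_1
    & (\prod_i F i)`_2 = \sum_i (F i)`_2
        + \sum_(i < m) \sum_(j < m | (i < j)%N) (F i)`_1 * (F j)`_1].
Proof.
elim: m F => [|m IHm] F F0; first by rewrite !big_ord0 !coef1 addr0.
have [i|p0 p1 p2] := IHm (fun i => F (lift ord0 i)); first exact: F0.
rewrite !big_ord_recl !coefM !big_ord_recr !big_ord0 /= !add0r !subn0 !subnn.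
rewrite p0 p1 p2 !F0 !mul1r !mulr1; split=> //; first by rewrite addrC.
have splitE (i : nat) (c : A) :
    \sum_(j < m.+1 | (i < j)%N) c * (F j)`_1 =
    \sum_(j < m | (i <= j)%N) c * (F (lift ord0 j))`_1.
  by rewrite big_mkcond big_ord_recl /= add0r [RHS]big_mkcond.
under [X in _ = _ + _ + (_ + X)]eq_bigr do rewrite splitE.
rewrite splitE mulr_sumr [LHS]addrC -!addrA.
by do 2![congr (_ + _)]; rewrite addrC.
Qed.

Lemma horner_prod_central (A : nzRingType) (m : nat) (F : 'I_m -> {poly A}) x :
  (forall y, GRing.comm x y) -> (\prod_i F i).[x] = \prod_i (F i).[x].
Proof.
move=> xC; elim: m F => [|m IHm] F; first by rewrite !big_ord0 hornerC.
by rewrite !big_ord_recl hornerM_comm ?IHm //; apply: xC.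
Qed.

Lemma poly_infinite_roots (K : fieldType) (e : nat -> K) (p : {poly K}) :
  injective e -> (forall k, root p (e k)) -> p = 0.
Proof.
move=> e_inj root_p; apply/eqP; apply: contraT => p0.
have := @max_poly_roots _ p (mkseq e (size p)) p0.
rewrite size_mkseq ltnn => -> //; last by rewrite mkseq_uniq.
by apply/allP => _ /mapP[k _ ->].
Qed.

Lemma sum_powers_eq0 (K : fieldType) (e : nat -> K) (d : nat) (c : nat -> K) :
  injective e -> (forall z, \sum_(k < d) z ^+ k * c k = 0) ->
  forall k, (k < d)%N -> c k = 0.
Proof.
move=> e_inj c0 k kd; have p0 : \poly_(i < d) c i = 0.
  apply: (poly_infinite_roots e_inj) => l; apply/eqP; rewrite horner_poly.
  by rewrite -[RHS](c0 (e l)); apply: eq_bigr => i _; rewrite mulrC.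
by have := coef_poly d c k; rewrite p0 coef0 kd.
Qed.

(** Applying [L] to the commutator of S(z) and S(z') gives a scalar polynomial in z and z' vanishing
    everywhere. Over an infinite field its coefficients vanish, one variable being treated at a
    time. *)
Lemma commuting_coefs (K : fieldType) (e : nat -> K) (A : algType K)
    (L : {linear A -> K^o}) (d : nat) (c : nat -> A) (S : K -> A) :
  injective e -> (forall z, S z = \sum_(k < d) z ^+ k *: c k) ->
  (forall z z', S z * S z' = S z' * S z) ->
  forall k l, (k < d)%N -> (l < d)%N -> L (c k * c l - c l * c k) = 0.
Proof.
move=> e_inj SE comm k l kd ld.
apply: (sum_powers_eq0 (d := d) (c := fun l => L (c k * c l - c l * c k)) e_inj) => // z'.
apply: (sum_powers_eq0 (d := d)
  (c := fun k => \sum_(l < d) z' ^+ l * L (c k * c l - c l * c k)) e_inj) => // z.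
transitivity (L (S z * S z' - S z' * S z)); last by rewrite comm subrr linear0.
rewrite !SE mulr_suml [X in _ - X]mulr_sumr -sumrB linear_sum /=.
apply: eq_bigr => i _.
rewrite mulr_sumr [X in L (X - _)]mulr_sumr [X in L (_ - X)]mulr_suml.
rewrite -sumrB linear_sum /=.
apply: eq_bigr => j _.
by rewrite -!scalerAl -!scalerAr !scalerA [z' ^+ j * _]mulrC -scalerBr linearZ.
Qed.
End PolynomialProducts.

Lemma prod_nat_adjacent (A : pzRingType) (m j : nat) (F : nat -> A) :
  (j.+1 < m)%N -> \prod_(k < m | (j <= k <= j.+1)%N) F k = F j * F j.+1.
Proof.
elim: j m F => [|j IHj] [|m] F // jm; rewrite big_mkcond big_ord_recl /=.
  by case: m jm => // m _; rewrite big_ord_recl /= big1 ?mulr1.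
by rewrite mul1r -(IHj m (F \o S)) // [RHS]big_mkcond.
Qed.

Lemma prod_ord_adjacent (A : pzRingType) (m : nat) (F : 'I_m -> A) (i j : 'I_m) :
  i = j.+1 :> nat -> \prod_(k < m | (j <= k <= i)%N) F k = F j * F i.
Proof.
move=> ij; pose G k := oapp F 1 (insub k).
have GE k : F k = G k by rewrite /G valK.
under eq_bigr do rewrite GE.
by rewrite !GE ij prod_nat_adjacent // -ij.
Qed.

(** In the decreasing product, linear terms from two factors give g_i g_j with j < i, while the
    quadratic term of one factor gives g_j g_(j+1). Together these are exactly the canonical
    pairs. *)
Lemma coef_prod_rev (A : nzRingType) (m : nat) (F : 'I_m -> {poly A})
    (g : 'I_m -> A) :
    (forall i, (F i)`_0 = 1) -> (forall i, (F i)`_1 = g i) ->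
    (forall i, (F i)`_2 = \sum_(j < m | i == j.+1 :> nat) g j * g i) ->
  (\prod_(i < m) F (rev_ord i))`_1 = \sum_i g i /\
  (\prod_(i < m) F (rev_ord i))`_2 =
    \sum_(i < m) \sum_(j < m | canonical_pair i j) g i * g j.
Proof.
move=> F0 F1 F2.
have [i|_ -> ->] := coef_prod_low (F := fun i => F (rev_ord i)); first exact: F0.
have E1 : \sum_(i < m) (F (rev_ord i))`_1 = \sum_i g i.
  by rewrite [RHS](reindex_inj rev_ord_inj); apply: eq_bigr.
have E2 : \sum_(i < m) (F (rev_ord i))`_2 =
    \sum_(i < m) \sum_(j < m | j == i.+1 :> nat) g i * g j.
  transitivity (\sum_(i < m) (F i)`_2).
    by rewrite [RHS](reindex_inj rev_ord_inj).
  by rewrite [RHS](exchange_big_dep predT) //; apply: eq_bigr => i _.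
have E3 : \sum_(i < m) \sum_(j < m | (i < j)%N)
      (F (rev_ord i))`_1 * (F (rev_ord j))`_1 =
    \sum_(i < m) \sum_(j < m | (j < i)%N) g i * g j.
  rewrite [RHS](reindex_inj rev_ord_inj); apply: eq_bigr => i _.
  rewrite [RHS](reindex_inj rev_ord_inj); apply: eq_big => [j|j _] /=.
    by rewrite ltn_sub2lE ?ltnS // ltn_ord.
  by rewrite !F1.
split=> //; rewrite E2 E3 -big_split; apply: eq_bigr => i _ /=.
rewrite [RHS](bigID (fun j : 'I_m => (j == i.+1 :> nat))) /=.
by congr (_ + _); apply: eq_bigl => j; rewrite /canonical_pair; lia.
Qed.

(** * The shuffle element as a polynomial in z *)

Section ShufflePolynomial.
Variables (K : fieldType) (q : K) (n : nat).
Local Notation T := (hecke_gen q).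

Definition hecke_X_poly (i : 'I_n.-1) : {poly hecke q n} :=
  \poly_(k < i.+2) \prod_(j < n.-1 | (i.+1 - k <= j <= i)%N) T j.

Definition shuffle_poly : {poly hecke q n} :=
  \prod_(i < n.-1) hecke_X_poly (rev_ord i).

Lemma shuffle_polyE z : shuffle_elt q n z = shuffle_poly.[z%:A].
Proof.
(* Evaluation respects products because [z%:A] is central. *)
rewrite horner_prod_central => [|x]; last by rewrite /GRing.comm mulr_algl mulr_algr.
apply: eq_bigr => i _; rewrite horner_poly; apply: eq_bigr => k _.
by rewrite -[z%:A]/(in_alg (hecke q n) z) -rmorphXn mulr_algr.
Qed.

Lemma hecke_X_poly0 i : (hecke_X_poly i)`_0 = 1.
Proof.
rewrite coef_poly /= big_pred0 // => j.
by rewrite subn0; case: ltngtP.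
Qed.

Lemma hecke_X_poly1 i : (hecke_X_poly i)`_1 = T i.
Proof.
rewrite coef_poly /= (eq_bigl (pred1 i)) ?big_pred1_eq // => j.
by rewrite subn1 /= -val_eqE /=; lia.
Qed.

Lemma hecke_X_poly2 i :
  (hecke_X_poly i)`_2 = \sum_(j < n.-1 | i == j.+1 :> nat) T j * T i.
Proof.
(* For i = 0 the polynomial has degree at most 1, matching the empty sum on the right. *)
rewrite coef_poly subSS; case: (posnP i) => [->|i0].
  by rewrite ltnn big_pred0.
have lt_pred : (i.-1 < n.-1)%N by apply: leq_ltn_trans (leq_pred i) _.
pose j := Ordinal lt_pred; have ij : i = j.+1 :> nat by rewrite /= prednK.
rewrite -[(2 < i.+2)%N]/(0 < i)%N i0 subn1 -[i.-1]/(j : nat) prod_ord_adjacent //.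
by rewrite (big_pred1 j) // => k; rewrite /= -val_eqE /=; lia.
Qed.


Lemma shuffle_poly1 : shuffle_poly`_1 = \sum_i T i.
Proof. by have [] := coef_prod_rev hecke_X_poly0 hecke_X_poly1 hecke_X_poly2. Qed.

Lemma shuffle_poly2 :
  shuffle_poly`_2 = \sum_(i < n.-1) \sum_(j < n.-1 | canonical_pair i j) T i * T j.
Proof. by have [] := coef_prod_rev hecke_X_poly0 hecke_X_poly1 hecke_X_poly2. Qed.
End ShufflePolynomial.

Lemma lrmorph_commutator (K : fieldType) (A B : algType K)
    (f : {lrmorphism A -> B}) (x y : A) :
  f (x * y - y * x) = f x * f y - f y * f x.
Proof. by rewrite rmorphB !rmorphM. Qed.

(** * Transfer from the Burau representation to the Hecke algebra *)

Section NonCommuting.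
Variables (K : fieldType) (q : K) (N : nat).
Hypotheses (q0 : q != 0) (N3 : (2 < N)%N).
Local Notation Y := (@hecke_Y K q N.+1).

(** The form is a matrix entry of the Burau representation. Being scalar valued, it serves both the
    commutator of Y_1 and Y_2 and the coefficient comparison for S. *)
Lemma hecke_separating_form :
  exists L : {linear hecke q N.+1 -> K^o}, L (Y 1%N * Y 2%N - Y 2%N * Y 1%N) != 0.
Proof.
have [f fE] := @hecke_lift_exists K q N.+1 _ (@burau K q N)
  (@burau_quadratic K q N) (@burau_commute K q N) (@burau_braid K q N).
have [a [b ab]] := burau_noncommuting q0 N3.
have eL : linear (fun x : hecke q N.+1 => (f x a b : K^o)).
  by move=> c x y; rewrite linearP !mxE.
pose L : {linear hecke q N.+1 -> K^o} :=
  HB.pack (fun x : hecke q N.+1 => (f x a b : K^o))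
    (GRing.isLinear.Build _ _ _ _ (fun x : hecke q N.+1 => (f x a b : K^o)) eL).
exists L; rewrite /L /=.
have f1 : f (Y 1%N) = \sum_i burau q i.
  by rewrite hecke_Y1 linear_sum; apply: eq_bigr => i _; apply: fE.
have f2 : f (Y 2%N) =
    \sum_(i < N) \sum_(j < N | canonical_pair i j) burau q i * burau q j.
  rewrite hecke_Y2 linear_sum; apply: eq_bigr => i _.
  by rewrite linear_sum; apply: eq_bigr => j _; rewrite rmorphM /= !fE.
by rewrite lrmorph_commutator f1 f2.
Qed.

Lemma hecke_Y12_noncommuting : Y 1%N * Y 2%N <> Y 2%N * Y 1%N.
Proof.
have [L L0] := hecke_separating_form => Y12.
by move: L0; rewrite Y12 subrr linear0 eqxx.
Qed.

Lemma shuffle_noncommuting (e : nat -> K) : injective e ->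
  exists z z', shuffle_elt q N.+1 z * shuffle_elt q N.+1 z' <>
    shuffle_elt q N.+1 z' * shuffle_elt q N.+1 z.
Proof.
move=> e_inj; have [L] := hecke_separating_form; apply: contra_neqP => nex.
(* Padding the size by 3 puts the indices 1 and 2 below [d] without computing the degree. *)
pose c k := (shuffle_poly q N.+1)`_k; pose d := (size (shuffle_poly q N.+1) + 3)%N.
have [d1 d2] : (1 < d)%N /\ (2 < d)%N by rewrite /d addn3.
rewrite hecke_Y1 hecke_Y2 -shuffle_poly1 -shuffle_poly2.
apply: (commuting_coefs (S := shuffle_elt q N.+1) (c := c) L e_inj _ _ d1 d2) => [z|z z'].
  rewrite shuffle_polyE (horner_coef_wide _ (leq_addr 3 _)).
  apply: eq_bigr => k _.
  by rewrite -[z%:A]/(in_alg (hecke q N.+1) z) -rmorphXn mulr_algr.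
by apply: contrapT => neq; apply: nex; exists z, z'.
Qed.
End NonCommuting.

(** The powers of the indeterminate supply the infinitely many scalars needed to compare
    coefficients. *)
Lemma fraction_powers_inj (F : fieldType) :
  injective (fun k => (tofrac 'X : {fraction {poly F}}) ^+ k).
Proof.
move=> k l /=; rewrite -!rmorphXn => /eqP; rewrite tofrac_eq => /eqP.
move/(congr1 (fun p : {poly F} => size p)).
by rewrite !size_polyXn => -[].
Qed.

Theorem theorem1p3 (R : realType) (n : nat) (hn : (4 <= n)%N) :
  let q : Cq R := Cq_indet R in
  let Y : nat -> hecke q n := @hecke_Y (Cq R) q n in
  let S : Cq R -> hecke q n := @shuffle_elt (Cq R) q n in
  let Y_noncommuting := exists i j : nat,
    [/\ (1 <= i <= 'C(n, 2))%N, (1 <= j <= 'C(n, 2))%N, i <> j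
      & Y i * Y j <> Y j * Y i] in
  let S_noncommuting := exists z z' : Cq R, S z * S z' <> S z' * S z in
  Y_noncommuting /\ (Y_noncommuting <-> S_noncommuting).
Proof.
case: n hn => // N N3 q Y S YN SN.
have q0 : q != 0.
  by rewrite /q /Cq_indet tofrac_eq0 polyX_eq0.
have hY : YN.
  have C2 : (2 <= 'C(N.+1, 2))%N.
    by apply: leq_trans (leq_bin2l 2 N3); rewrite !binS.
  have [C1 C2'] : (1 <= 1 <= 'C(N.+1, 2))%N /\ (1 <= 2 <= 'C(N.+1, 2))%N.
    by rewrite C2 (ltnW C2).
  exists 1%N, 2%N; split; [exact: C1|exact: C2'|by []|].
  exact: (hecke_Y12_noncommuting q0 N3).
split; first exact: hY.
(* Both sides of the equivalence hold, so each implication follows from its conclusion. *)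
split=> _; last exact: hY.
exact: (shuffle_noncommuting q0 N3 (@fraction_powers_inj _)).
Qed.
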